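(* Suppose $0<\eta<\frac{1}{\lambda_{\max,0}}$, and let $(\theta_k)_{k\ge 0}$ be the SGD iterates with constant step-size $\eta$. (1) If the functions $f,f_1,\dots,f_J$ satisfy the $\lambda$-smooth assumption, then for all $k\ge 0$ $$R_{k+1}-R_k\;\geq\; -2\eta\lambda_{\max,0}\,R_k-2\eta^2\Lambda D_0R_k^{1/2}+\eta^2D_0^2 .$$ (2) If in addition $f$ satisfies the strongly convex assumption, then for all $k\ge 0$ $$R_{k+1}-R_k\;\leq\; \left[-2\eta\lambda_{\min}+\eta^2\left(\lambda_{\max,0}^2+\Lambda^2-\lambda_{\min}^2\right)\right]R_k+2\eta^2\Lambda D_0R_k^{1/2}+\eta^2D_0^2 .$$
   Context: Let $d,J\ge 1$, let $f_1,\dots,f_J:\mathbb{R}^d\to\mathbb{R}$ be differentiable, and let $f=\frac1J\sum_{j=1}^J f_j$. Let $\theta^\dagger\in\mathbb{R}^d$ be an optimal solution (global minimizer) of $\min_{\theta\in\mathbb{R}^d} f(\theta)$, assumed to exist; in particular $\nabla f(\theta^\dagger)=0$. $|\cdot|$ denotes the Euclidean norm and $\langle\cdot,\cdot\rangle$ the Euclidean inner product. $\lambda$-smooth assumption: there are constants $\lambda_{\max,0},\lambda_{\max,1},\dots,\lambda_{\max,J}>0$ such that for all $\theta_1,\theta_2\in\mathbb{R}^d$: $|\nabla f(\theta_1)-\nabla f(\theta_2)|\le\lambda_{\max,0}|\theta_1-\theta_2|$ and $|\nabla f_j(\theta_1)-\nabla f_j(\theta_2)|\le\lambda_{\max,j}|\theta_1-\theta_2|$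 for every $j=1,\dots,J$. Strongly convex assumption: there is a constant $\lambda_{\min}>0$ such that $\langle\nabla f(\theta_1)-\nabla f(\theta_2),\theta_1-\theta_2\rangle\ge\lambda_{\min}|\theta_1-\theta_2|^2$ for all $\theta_1,\theta_2\in\mathbb{R}^d$. Notation: $D_0=\left(\frac1J\sum_{j=1}^J|\nabla f_j(\theta^\dagger)|^2\right)^{1/2}$ and $\Lambda=\left(\frac1J\sum_{j=1}^J\lambda_{\max,j}^2\right)^{1/2}$. SGD with constant step-size $\eta>0$: $\theta_{k+1}=\theta_k-\eta\nabla f_{\gamma_k}(\theta_k)$ for $k\ge 0$, where $\gamma_0,\gamma_1,\dots$ are i.i.d. uniform on $\{1,\dots,J\}$ and the initial point $\theta_0$ (possibly random) is independent of $(\gamma_k)_{k\ge0}$ with $\mathbb{E}|\theta_0-\theta^\dagger|^2<\infty$. The error is $R_k=\mathbb{E}|\theta_k-\theta^\dagger|^2$. *)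

(* Defs.v *)
From HB Require Import structures.
From mathcomp Require Import all_boot all_order all_algebra.
From mathcomp Require Import finmap.
From mathcomp Require Import all_classical all_reals all_analysis.

Set Implicit Arguments.
Unset Strict Implicit.
Unset Printing Implicit Defensive.

Import Order.TTheory GRing.Theory Num.Theory.
Import numFieldNormedType.Exports.

Local Open Scope classical_set_scope.
Local Open Scope ring_scope.

Definition dotv (R : realType) (d : nat) (u v : 'rV[R]_d) : R :=
  \sum_(i < d) u 0 i * v 0 i.

(* The library's norm on 'rV[R]_d is the sup norm; this is the Euclidean one.
   Both induce the same topology, hence the same differentiability and Borel
   sets. *)
Definition enorm (R : realType) (d : nat) (u : 'rV[R]_d) : R :=
  Num.sqrt (dotv u u).

Definition gradient (R : realType) (d : nat) (f : 'rV[R]_d -> R)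
    (x : 'rV[R]_d) : 'rV[R]_d :=
  \row_(i < d) 'D_(delta_mx 0 i) f x.

Definition avg (R : realType) (J : nat) (a : 'I_J -> R) : R :=
  J%:R^-1 * \sum_(j < J) a j.

Definition lipschitz_gradient (R : realType) (d : nat) (f : 'rV[R]_d -> R)
    (L : R) : Prop :=
  forall x y : 'rV[R]_d,
    enorm (gradient f x - gradient f y) <= L * enorm (x - y).

Definition lambda_smooth (R : realType) (d J : nat)
    (f : 'rV[R]_d -> R) (fs : 'I_J -> 'rV[R]_d -> R)
    (lmax0 : R) (lmax : 'I_J -> R) : Prop :=
  [/\ 0 < lmax0, forall j, 0 < lmax j,
      lipschitz_gradient f lmax0 &
      forall j, lipschitz_gradient (fs j) (lmax j)].

Definition strongly_convex (R : realType) (d : nat) (f : 'rV[R]_d -> R)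
    (lmin : R) : Prop :=
  0 < lmin /\
  forall x y : 'rV[R]_d,
    lmin * enorm (x - y) ^+ 2 <= dotv (gradient f x - gradient f y) (x - y).

Definition borel_rV (R : realType) (d : nat) : set (set 'rV[R]_d) :=
  <<s [set U : set 'rV[R]_d | open U] >>.

(* sigma-algebra generated by a map X into a space with sigma-algebra E *)
Definition sigma_gen (T U : Type) (E : set (set U)) (X : T -> U) :
    set (set T) :=
  preimage_set_system setT X E.

Definition random_element (dsp : measure_display) (T : measurableType dsp)
    (U : Type) (E : set (set U)) (X : T -> U) : Prop :=
  sigma_gen E X `<=` measurable.

Definition mutually_independent (dsp : measure_display)
    (T : measurableType dsp) (R : realType) (P : probability T R)
    (I : choiceType) (F : I -> set (set T)) : Prop :=
  forall (K : {fset I}) (A : I -> set T),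
    (forall i, i \in K -> F i (A i)) ->
    P (\bigcap_(i in [set` K]) A i) = (\prod_(i <- K) P (A i))%E.

Definition independent2 (dsp : measure_display)
    (T : measurableType dsp) (R : realType) (P : probability T R)
    (F G : set (set T)) : Prop :=
  forall A B : set T, F A -> G B -> P (A `&` B) = (P A * P B)%E.

(* 'I_J carries the discrete sigma-algebra setT : set (set 'I_J). *)
Definition iid_uniform (dsp : measure_display) (T : measurableType dsp)
    (R : realType) (P : probability T R) (J : nat)
    (gamma : nat -> T -> 'I_J) : Prop :=
  [/\ forall k, random_element setT (gamma k),
      forall k j, P (gamma k @^-1` [set j]) = (J%:R^-1)%:E &
      mutually_independent P (fun k => sigma_gen setT (gamma k))].

(* sigma-algebra generated by the whole sequence *)
Definition sigma_gen_seq (T : Type) (J : nat) (gamma : nat -> T -> 'I_J) :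
    set (set T) :=
  <<s \bigcup_k sigma_gen setT (gamma k) >>.

(* Mean squared error; it is kept in \bar R, so that no value is assigned by
   convention when the expectation is infinite. *)
Definition mse (dsp : measure_display) (T : measurableType dsp)
    (R : realType) (P : probability T R) (d : nat)
    (X : T -> 'rV[R]_d) (x : 'rV[R]_d) : \bar R :=
  'E_P[fun w => enorm (X w - x) ^+ 2].

(* Main.v *)
Require Import Defs.
From mathcomp Require Import all_boot all_order all_algebra.
From mathcomp Require Import finmap.
From mathcomp Require Import all_classical all_reals all_analysis.
From mathcomp Require Import measurable_realfun.
From mathcomp Require Import ring lra.
Import Order.TTheory GRing.Theory Num.Theory.
Import numFieldNormedType.Exports.
Local Open Scope classical_set_scope.
Local Open Scope ring_scope.

(** Write [e = x - xopt] for the current error.  One SGD step from a fixed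
    point [x] with label [j] has squared error [|e - eta grad f_j(x)|^2], and
    averaging over the uniform label gives
[[
  |e|^2 - 2 eta <grad f(x) - grad f(xopt), e> + eta^2 avg_j |grad f_j(x)|^2,
]]
    because [grad f] is the average of the [grad f_j] and vanishes at the
    minimizer.  The inner product lies below [lmax0 |e|^2] by Cauchy-Schwarz
    and above [lmin |e|^2] by strong convexity.  For the last average, split
    [grad f_j(x)] into [grad f_j(xopt)] plus a remainder of norm at most
    [lmax_j |e|]: the squares of the two parts contribute [D0^2] and at most
    [Lambda^2 |e|^2], and the cross terms are at most [2 Lambda D0 |e|] by
    Cauchy-Schwarz over [j] ([second_moment_ge], [second_moment_le]).  Hence
    the averaged squared error lies between two quadratic polynomials in [|e|]
    ([step_error_ge], [step_error_le_strongly_convex]).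

    It remains to integrate over [x = theta_k].  Averaging over the label is
    legitimate because [theta_k] is independent of [gamma_k].  This is proved
    by induction on [k] in a form that avoids conditional expectations: for
    every Borel set [B] and every word [s] over the labels, the event
    [theta_k \in B] is independent of the event that [gamma_k, gamma_(k+1),
    ...] starts with [s] ([chain_cylinder_indep]).  Splitting on the value of
    [gamma_k] turns a statement about [theta_(k+1)] and [s] into statements
    about [theta_k] and the words [j :: s], which is why whole words are
    needed.  Comparing push-forward measures upgrades this from events to
    integrals ([ge0_integral_chainS]).  Finally [E|e| <= (E|e|^2)^(1/2)]
    turns the expectation of the linear term into [R_k^(1/2)].  The same upper
    bound with [- lmax0] in place of [lmin] ([step_error_le]) shows by
    induction that every [R_k] is finite, so that the extended-real
    inequalities are inequalities between real numbers. *)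

Set Implicit Arguments.
Unset Strict Implicit.
Unset Printing Implicit Defensive.

(** * Euclidean geometry and averages *)

Lemma enorm_ge0 (R : realType) (d : nat) (u : 'rV[R]_d) : 0 <= enorm u.
Proof. exact: sqrtr_ge0. Qed.

Lemma enorm_sqr (R : realType) (d : nat) (u : 'rV[R]_d) :
  enorm u ^+ 2 = dotv u u.
Proof. by rewrite sqr_sqrtr// sumr_ge0// => i _; rewrite -expr2 sqr_ge0. Qed.

Lemma dotvC (R : realType) (d : nat) (u v : 'rV[R]_d) : dotv u v = dotv v u.
Proof. by apply: eq_bigr => i _; rewrite mulrC. Qed.

Lemma dotvDl (R : realType) (d : nat) (u v w : 'rV[R]_d) :
  dotv (u + v) w = dotv u w + dotv v w.
Proof. by rewrite -big_split; apply: eq_bigr => i _; rewrite mxE mulrDl. Qed.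

Lemma dotvZl (R : realType) (d : nat) (c : R) (u v : 'rV[R]_d) :
  dotv (c *: u) v = c * dotv u v.
Proof. by rewrite mulr_sumr; apply: eq_bigr => i _; rewrite mxE mulrA. Qed.

Lemma dotv_suml (R : realType) (d J : nat) (g : 'I_J -> 'rV[R]_d) v :
  dotv (\sum_j g j) v = \sum_j dotv (g j) v.
Proof.
rewrite exchange_big; apply: eq_bigr => i _.
by rewrite summxE mulr_suml.
Qed.

Lemma enorm_sqrDZ (R : realType) (d : nat) (c : R) (u v : 'rV[R]_d) :
  enorm (u + c *: v) ^+ 2 =
  enorm u ^+ 2 + 2 * c * dotv v u + c ^+ 2 * enorm v ^+ 2.
Proof.
rewrite !enorm_sqr dotvDl (dotvC u) (dotvC (c *: v)) !dotvDl !dotvZl.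
rewrite (dotvC u (c *: v)) (dotvC v (c *: v)) !dotvZl; ring.
Qed.

(** Expand the squared norm of [u] minus its projection on [v], which is
    nonnegative. *)
Lemma cauchy_schwarz (R : realType) (d : nat) (u v : 'rV[R]_d) :
  `|dotv u v| <= enorm u * enorm v.
Proof.
rewrite -ler_sqr ?nnegrE ?normr_ge0// ?mulr_ge0 ?enorm_ge0//.
rewrite real_normK ?num_real// exprMn.
(* The projection divides by [|v|^2], so [v = 0] is treated apart. *)
have [v0|v0] := eqVneq (enorm v) 0.
  have /eqP : dotv v v = 0 by rewrite -enorm_sqr v0 expr0n.
  rewrite psumr_eq0 => [/allP v00|i _]; last by rewrite -expr2 sqr_ge0.
  have -> : dotv u v = 0.
    rewrite /dotv big1// => i _; have := v00 i (mem_index_enum _).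
    by rewrite -expr2 sqrf_eq0 => /eqP ->; rewrite mulr0.
  by rewrite expr0n mulr_ge0 ?sqr_ge0.
have v2 : 0 < enorm v ^+ 2 by rewrite exprn_gt0// lt_neqAle eq_sym v0 enorm_ge0.
have := sqr_ge0 (enorm (u + (- (dotv v u / enorm v ^+ 2)) *: v)).
rewrite enorm_sqrDZ (dotvC u).
rewrite -(pmulr_rge0 _ v2) => h; rewrite -subr_ge0.
suff -> : enorm u ^+ 2 * enorm v ^+ 2 - dotv v u ^+ 2 =
  enorm v ^+ 2 * (enorm u ^+ 2 + 2 * - (dotv v u / enorm v ^+ 2) * dotv v u +
  (- (dotv v u / enorm v ^+ 2)) ^+ 2 * enorm v ^+ 2) by [].
by field.
Qed.

Lemma avgD (R : realType) (J : nat) (a b : 'I_J -> R) :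
  avg (fun j => a j + b j) = avg a + avg b.
Proof. by rewrite /avg big_split mulrDr. Qed.

Lemma avgZ (R : realType) (J : nat) (c : R) (a : 'I_J -> R) :
  avg (fun j => c * a j) = c * avg a.
Proof. by rewrite /avg -mulr_sumr mulrCA. Qed.

Lemma avg_cst (R : realType) (J : nat) (c : R) :
  (0 < J)%N -> avg (fun _ : 'I_J => c) = c.
Proof.
move=> J0; rewrite /avg sumr_const card_ord -(mulr_natl c) mulKf//.
by rewrite pnatr_eq0 -lt0n.
Qed.

Lemma ler_avg (R : realType) (J : nat) (a b : 'I_J -> R) :
  (forall j, a j <= b j) -> avg a <= avg b.
Proof. by move=> ab; rewrite ler_wpM2l ?invr_ge0 ?ler_sum. Qed.

Lemma avg_ge0 (R : realType) (J : nat) (a : 'I_J -> R) :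
  (forall j, 0 <= a j) -> 0 <= avg a.
Proof. by move=> a0; rewrite mulr_ge0 ?invr_ge0 ?sumr_ge0. Qed.

Lemma avg_cauchy_schwarz (R : realType) (J : nat) (a b : 'I_J -> R) :
  avg (fun j => a j * b j) <=
  Num.sqrt (avg (fun j => a j ^+ 2)) * Num.sqrt (avg (fun j => b j ^+ 2)).
Proof.
have cs := le_trans (ler_norm _)
  (@cauchy_schwarz R J (\row_j a j) (\row_j b j)).
rewrite /avg !sqrtrM ?invr_ge0// mulrACA -expr2 sqr_sqrtr ?invr_ge0//.
rewrite ler_wpM2l ?invr_ge0//; move: cs; rewrite /enorm /dotv.
under eq_bigr do rewrite !mxE.
under [in X in Num.sqrt X * _]eq_bigr do rewrite !mxE -expr2.
by under [in X in _ * Num.sqrt X]eq_bigr do rewrite !mxE -expr2.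
Qed.

(** The mean squared distance after a step in a uniformly chosen direction:
    the inner product sees only the mean direction. *)
Lemma avg_sqr_step (R : realType) (d J : nat) (eta : R) (e : 'rV[R]_d)
    (g : 'I_J -> 'rV[R]_d) : (0 < J)%N ->
  avg (fun j => enorm (e - eta *: g j) ^+ 2) =
  enorm e ^+ 2 - 2 * eta * dotv (J%:R^-1 *: \sum_j g j) e
  + eta ^+ 2 * avg (fun j => enorm (g j) ^+ 2).
Proof.
move=> J0; rewrite dotvZl dotv_suml -/(avg _).
under [X in avg X = _]funext do rewrite -scaleNr enorm_sqrDZ.
by rewrite !avgD !avgZ avg_cst// sqrrN mulrN mulNr.
Qed.

Section second_moment.
Context {R : realType} {d J : nat} (a g : 'I_J -> 'rV[R]_d) (l : 'I_J -> R).
Context (t : R) (t0 : 0 <= t).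
Hypothesis gal : forall j, enorm (g j - a j) <= l j * t.

Let D := Num.sqrt (avg (fun j => enorm (a j) ^+ 2)).
Let L := Num.sqrt (avg (fun j => l j ^+ 2)).

Let split_sqr j : enorm (g j) ^+ 2 =
  enorm (a j) ^+ 2 + 2 * dotv (g j - a j) (a j) + enorm (g j - a j) ^+ 2.
Proof.
rewrite -{1}(subrK (a j) (g j)) addrC -{1}(scale1r (g j - a j)).
by rewrite enorm_sqrDZ mulr1 expr1n mul1r.
Qed.

Let D2 : D ^+ 2 = avg (fun j => enorm (a j) ^+ 2).
Proof. by rewrite sqr_sqrtr// avg_ge0// => j; exact: sqr_ge0. Qed.

Let L2 : L ^+ 2 = avg (fun j => l j ^+ 2).
Proof. by rewrite sqr_sqrtr// avg_ge0// => j; exact: sqr_ge0. Qed.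

Let cross j : `|dotv (g j - a j) (a j)| <= t * (l j * enorm (a j)).
Proof.
apply: le_trans (cauchy_schwarz _ _) _.
by rewrite mulrA (mulrC t) ler_wpM2r// enorm_ge0.
Qed.

Let avg_cross : avg (fun j => l j * enorm (a j)) <= L * D.
Proof. exact: avg_cauchy_schwarz. Qed.

(** Around reference vectors [a j], the mean square of the [g j] differs from
    that of the [a j] by the cross terms, controlled by [cross] and
    [avg_cross], and by the mean square of the remainders, which is only
    bounded below by [0] here. *)
Lemma second_moment_ge :
  D ^+ 2 - 2 * L * D * t <= avg (fun j => enorm (g j) ^+ 2).
Proof.
apply: (@le_trans _ _ (avg (fun j =>
    enorm (a j) ^+ 2 + (- (2 * t)) * (l j * enorm (a j))))).
  rewrite avgD avgZ D2 lerD2l; have := ler_wpM2l t0 avg_cross; lra.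
apply: ler_avg => j; rewrite split_sqr -addrA lerD2l.
have := cross j; rewrite ler_norml => /andP[h _].
have := sqr_ge0 (enorm (g j - a j)); lra.
Qed.

Lemma second_moment_le :
  avg (fun j => enorm (g j) ^+ 2) <= D ^+ 2 + 2 * L * D * t + L ^+ 2 * t ^+ 2.
Proof.
apply: (@le_trans _ _ (avg (fun j =>
    enorm (a j) ^+ 2 + (2 * t) * (l j * enorm (a j)) + t ^+ 2 * l j ^+ 2))).
  apply: ler_avg => j; rewrite split_sqr -!addrA lerD2l.
  have := cross j; rewrite ler_norml => /andP[_ h].
  have : enorm (g j - a j) ^+ 2 <= (l j * t) ^+ 2.
    by rewrite ler_sqr ?nnegrE ?enorm_ge0 ?(le_trans (enorm_ge0 _) (gal j)).
  rewrite exprMn; lra.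
rewrite !avgD !avgZ D2 L2; have := ler_wpM2l t0 avg_cross; lra.
Qed.

End second_moment.

(** * Gradients *)

Lemma avg_funE (R : realType) (d J : nat) (fs : 'I_J -> 'rV[R]_d -> R) :
  (fun y => avg (fun j => fs j y)) = J%:R^-1 \*: (\sum_j fs j).
Proof. by apply/funext => y; rewrite /avg /= fct_sumE. Qed.

Lemma gradient_avg (R : realType) (d J : nat) (fs : 'I_J -> 'rV[R]_d -> R) x :
  (forall j y, differentiable (fs j) y) ->
  gradient (fun y => avg (fun j => fs j y)) x =
  J%:R^-1 *: \sum_j gradient (fs j) x.
Proof.
move=> dfs; apply/rowP => i; rewrite !mxE summxE.
under [in RHS]eq_bigr do rewrite mxE.
rewrite avg_funE; have dj j : derivable (fs j) x (delta_mx 0 i)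
  by exact: diff_derivable.
by rewrite deriveZ ?derive_sum//; exact: derivable_sum.
Qed.

(** Fermat's rule, from the one-dimensional rule along each coordinate line. *)
Lemma gradient_at_min (R : realType) (d : nat) (f : 'rV[R]_d -> R) x :
  (forall y, differentiable f y) -> (forall y, f x <= f y) ->
  gradient f x = 0.
Proof.
move=> df fmin; apply/rowP => i; rewrite !mxE; set v := delta_mx 0 i.
pose g (h : R) := f (h *: v + x).
have dg t : derivable g t 1.
  apply: diff_derivable.
  exact: (@differentiable_comp _ _ _ _ (fun h : R => h *: v + x) f).
have g0 : is_derive (0 : R) (1 : R) g (0 : R).
  apply: (@derive1_at_min _ g (-1) 1).
  - by rewrite ge0_cp.
  - by move=> t _; exact: dg.
  - by rewrite in_itv /= ltrN10 ltr01.
  - by move=> t _; rewrite /g scale0r add0r.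
have <- : 'D_(1 : R) g (0 : R) = 0 by exact: (@derive_val _ _ _ _ _ _ _ g0).
suff : (fun h : R => h^-1 *: ((f \o shift x) (h *: v) - f x)) =
    (fun h : R => h^-1 *: ((g \o shift (0 : R)) (h *: (1 : R)) - g 0)).
  by rewrite /derive => ->.
apply/funext => h /=.
by rewrite /g scale0r !add0r addr0 [_%:A]mulr1.
Qed.

(** * Continuity and Borel measurability *)

Lemma enorm_continuous (R : realType) (d : nat) : continuous (@enorm R d).
Proof.
move=> x; rewrite /enorm /dotv.
apply: (continuous_comp (f := fun u : 'rV[R]_d => \sum_(i < d) u 0 i * u 0 i));
  last exact: sqrt_continuous.
have : continuous (fun u : 'rV[R]_d => \sum_(i < d) u 0 i * u 0 i);
  last exact.
apply: continuous_big => [|i _ u]; first exact: add_continuous.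
by apply: (@continuousM _ _ (fun v : 'rV[R]_d => v 0 i));
  exact: coord_continuous.
Qed.

(** The topology of ['rV[R]_d] comes from the sup norm, so a comparison of
    the two norms transfers Lipschitz bounds to continuity. *)
Lemma norm_le_enorm (R : realType) (d : nat) (u : 'rV[R]_d) : `|u| <= enorm u.
Proof.
have [u0|u0] := eqVneq `|u| 0; first by rewrite u0 enorm_ge0.
have [[i j] ->] : exists i, `|u| = `|u i.1 i.2| := mx_norm_neq0 u0.
rewrite /= ord1.
rewrite -ler_sqr ?nnegrE ?enorm_ge0// real_normK ?num_real// enorm_sqr.
rewrite /dotv (bigD1 j)//= expr2 lerDl sumr_ge0// => k _.
by rewrite -expr2 sqr_ge0.
Qed.

Lemma lipschitz_enorm_continuous (R : realType) (d : nat)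
    (G : 'rV[R]_d -> 'rV[R]_d) (L : R) :
  (forall x y, enorm (G x - G y) <= L * enorm (x - y)) -> continuous G.
Proof.
move=> GL x; apply/(@cvgrPdist_lt _ _ _ _ (nbhs_filter x)) => e e0.
have e00 : enorm (0 : 'rV[R]_d) = 0.
  by rewrite /enorm /dotv big1 ?sqrtr0// => i _; rewrite mxE mul0r.
have h : {for x, continuous (fun y : 'rV[R]_d => L * enorm (x - y))}.
  apply: (@continuousM _ _ (fun=> L)); first exact: cst_continuous.
  apply: (@continuous_comp _ _ _ (fun y : 'rV[R]_d => x - y) (@enorm R d));
    last exact: enorm_continuous.
  apply: (@continuousB _ _ _ (fun=> x) id); first exact: cst_continuous.
  by move=> ?.
have := @cvgr_lt _ _ _ _ (fun y : 'rV[R]_d => L * enorm (x - y)) _ h e.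
rewrite subrr e00 mulr0 => /(_ (nbhs_filter x) e0); apply: filterS => y.
by apply: le_lt_trans; apply: le_trans (norm_le_enorm _) (GL _ _).
Qed.

(** The row vectors with the sigma-algebra generated by the open sets; its
    measurable sets are those of [borel_rV]. *)
Local Notation borelType R d :=
  (g_sigma_algebraType [set U : set 'rV[R]_d | open U]).

Lemma continuous_measurable_borel (R : realType) (d : nat)
    (F : 'rV[R]_d -> 'rV[R]_d) : continuous F ->
  measurable_fun (setT : set (borelType R d))
    (F : borelType R d -> borelType R d).
Proof.
move=> /continuousP cF.
apply: (@measurability _ _ (borelType R d) (borelType R d) _ _
    [set U : set 'rV[R]_d | open U]) => //.
move=> _ [U oU <-]; apply: sub_sigma_algebra; rewrite setTI; exact: cF.
Qed.

Lemma continuous_measurable_real (R : realType) (d : nat)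
    (h : 'rV[R]_d -> R) : continuous h ->
  measurable_fun (setT : set (borelType R d)) (h : borelType R d -> R).
Proof.
move=> /continuousP ch; apply: (@measurability _ _ (borelType R d) _ _ _ _
    (RGenOpens.measurableE R)).
move=> _ [_ [a [b ->] <-]]; apply: sub_sigma_algebra; rewrite setTI.
exact/ch/interval_open.
Qed.

Lemma continuous_gradient_step (R : realType) (d : nat)
    (G : 'rV[R]_d -> 'rV[R]_d) (eta : R) :
  continuous G -> continuous (fun x : 'rV[R]_d => x - eta *: G x).
Proof.
move=> cG x; apply: (@continuousB _ _ _ id (eta \*: G) x).
  by move=> ?.
by apply: (@continuousZl_tmp _ _ _ G eta x); exact: cG.
Qed.

(** * Chains driven by independent uniform labels *)

(** The event that the labels from time [k] on start with the word [s];
    the recursion makes the first letter split off by computation. *)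
Fixpoint cylinder (T : Type) (J : nat) (gamma : nat -> T -> 'I_J) (k : nat)
    (s : seq 'I_J) : set T :=
  if s is j :: s' then gamma k @^-1` [set j] `&` cylinder gamma k.+1 s'
  else setT.

(** The form in which mutual independence of the labels applies; [j0] is the
    default value of [nth], which is only read below [size s]. *)
Lemma cylinder_bigcap (T : Type) (J : nat) (j0 : 'I_J)
    (gamma : nat -> T -> 'I_J) k s :
  cylinder gamma k s = \bigcap_(i in [set` [fset i in iota k (size s)]%fset])
    gamma i @^-1` [set nth j0 s (i - k)].
Proof.
elim: s k => [|j s IH] k /=.
  by apply/seteqP; split => // w _ i /=; rewrite inE.
rewrite IH; apply/seteqP; split => w /=.
- move=> [kj sw] i /=; rewrite !inE => /predU1P[->|ik]; first by rewrite subnn.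
  have := sw i; rewrite /= !inE => /(_ ik) ->.
  move: ik; rewrite mem_iota => /andP[ki _].
  by rewrite -(subnSK ki).
- move=> sw; split.
    by have := sw k; rewrite /= !inE eqxx subnn => /(_ isT).
  move=> i /=; rewrite inE => ik.
  have := sw i; rewrite /= !inE ik orbT => /(_ isT) ->.
  by move: ik; rewrite mem_iota => /andP[ki _]; rewrite -(subnSK ki).
Qed.

Lemma cylinder_sigma_gen_seq (T : pointedType) (J : nat)
    (gamma : nat -> T -> 'I_J) k s :
  sigma_gen_seq gamma (cylinder gamma k s).
Proof.
rewrite /sigma_gen_seq; set G := \bigcup_k _.
elim: s k => [|j s IH] k; first exact: (@measurableT _ (g_sigma_algebraType G)).
apply: (@measurableI _ (g_sigma_algebraType G)); last exact: IH.
apply: sub_sigma_algebra; exists k => //; exists [set j] => //.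
by rewrite setTI.
Qed.

Section iid_labels.
Context {dsp : measure_display} {T : measurableType dsp} {R : realType}
  {P : probability T R} {J : nat} {gamma : nat -> T -> 'I_J}.
Hypothesis hgamma : iid_uniform P gamma.

Lemma measurable_label k j : measurable (gamma k @^-1` [set j]).
Proof.
by case: hgamma => mg _ _; apply: (mg k); exists [set j]; rewrite ?setTI.
Qed.

Lemma measurable_cylinder k s : measurable (cylinder gamma k s).
Proof.
elim: s k => [|j s IH] k; first exact: measurableT.
by apply: measurableI; [exact: measurable_label|exact: IH].
Qed.

Lemma prob_cylinder (J0 : (0 < J)%N) k s :
  P (cylinder gamma k s) = (J%:R^-1 ^+ size s)%:E.
Proof.
case: hgamma => mg ug ig; rewrite (cylinder_bigcap (Ordinal J0)) ig; last first.
  by move=> i _; eexists; [|rewrite setTI; reflexivity].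
under eq_bigr do rewrite ug.
rewrite big_const_seq count_predT card_fseq undup_id ?iota_uniq// size_iota.
by elim: (size s) => //= n ->; rewrite -EFinM exprS.
Qed.

Lemma labels_cover k :
  \big[setU/set0]_(j <- index_enum 'I_J) gamma k @^-1` [set j] = setT.
Proof.
apply/seteqP; split => // w _.
by rewrite -bigcup_seq; exists (gamma k w) => //=; rewrite mem_index_enum.
Qed.

Lemma labels_trivIset k (D : set 'I_J) :
  trivIset D (fun j => gamma k @^-1` [set j]).
Proof. by move=> i j _ _ [w [/= <- <-]]. Qed.

Lemma prob_split_label k A : measurable A ->
  P A = (\sum_(j < J) P (A `&` gamma k @^-1` [set j]))%E.
Proof.
move=> mA; rewrite -{1}(setIT A) -(labels_cover k) big_distrr/=.
rewrite measure_bigsetU_ord// => [j|].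
  by apply: measurableI => //; exact: measurable_label.
by apply: trivIset_setIl; exact: labels_trivIset.
Qed.

Lemma ge0_integral_split_label k (h : T -> \bar R) :
  measurable_fun setT h -> (forall w, 0 <= h w)%E ->
  (\int[P]_w h w =
   \sum_(j < J) \int[P]_(w in gamma k @^-1` [set j]) h w)%E.
Proof.
move=> mh h0; rewrite -(labels_cover k) ge0_integral_bigsetU//.
- by move=> j; exact: measurable_label.
- exact: index_enum_uniq.
- exact: labels_trivIset.
- by rewrite labels_cover.
Qed.

End iid_labels.

(** Independence of [X] from the event [A], with [p] the probability of [A],
    says that the laws of [X] under [P] restricted to [A] and under [p P]
    agree; so do the integrals of the identity against them. *)
Lemma integral_independent_event (dsp : measure_display)
    (T : measurableType dsp) (R : realType) (P : probability T R)
    (X : T -> R) (A : set T) (p : {nonneg R}) :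
  measurable_fun setT X -> (forall w, 0 <= X w) -> measurable A ->
  (forall B, measurable B ->
     P (X @^-1` B `&` A) = (P (X @^-1` B) * p%:num%:E)%E) ->
  (\int[P]_(w in A) (X w)%:E = p%:num%:E * \int[P]_w (X w)%:E)%E.
Proof.
move=> mX X0 mA indep.
(* [`|r|] in place of [r] makes the integrand nonnegative on all of [R], as
   the change of variables requires, and is [r] on the range of [X]. *)
have normX (m : {measure set T -> \bar R}) : (\int[m]_w (X w)%:E =
    \int[pushforward m X]_(r in [set: R]) (`|r|)%:E)%E.
  rewrite [RHS](ge0_integral_pushforward mX)//=; last first.
    by apply/(measurable_EFinP setT (@Num.norm R R)); exact: normr_measurable.
  by apply: eq_integral => w _; rewrite ger0_norm.
rewrite (eq_measure_integral (mrestr P mA)); last first.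
  by move=> B mB BA; rewrite /mrestr /=; congr (P _); apply/esym/setIidl.
transitivity (\int[mrestr P mA]_w (X w)%:E)%E.
  rewrite [RHS](@ge0_negligible_integral _ _ _ _ _ (~` A))//.
  - by rewrite setTD setCK.
  - exact: measurableC.
  - exact/measurable_EFinP.
  - by move=> w _; rewrite lee_fin.
  - by rewrite /= /mrestr setICl measure0.
rewrite !normX -ge0_integral_mscale//; last first.
  by apply/measurable_EFinP; exact: normr_measurable.
apply: eq_measure_integral => B mB _.
by rewrite /= /mscale/= /mrestr /pushforward/= indep// muleC.
Qed.

Section chain.
Context {dsp dspS : measure_display} {T : measurableType dsp}
  {S : measurableType dspS} {R : realType} {P : probability T R} {J : nat}.
Context {gamma : nat -> T -> 'I_J} {F : 'I_J -> S -> S} {X : nat -> T -> S}.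
Hypothesis J0 : (0 < J)%N.
Hypothesis hgamma : iid_uniform P gamma.
Hypothesis mF : forall j, measurable_fun setT (F j).
Hypothesis mX0 : measurable_fun setT (X 0).
Hypothesis X0_indep : forall B s, measurable B ->
  P (X 0 @^-1` B `&` cylinder gamma 0 s) =
  (P (X 0 @^-1` B) * P (cylinder gamma 0 s))%E.
Hypothesis XS : forall k w, X k.+1 w = F (gamma k w) (X k w).

Let preimage_step k B j : X k.+1 @^-1` B `&` gamma k @^-1` [set j] =
  X k @^-1` (F j @^-1` B) `&` gamma k @^-1` [set j].
Proof.
by apply/seteqP; split => w /= [XB gj]; split => //; move: XB; rewrite XS gj.
Qed.

Let mFpre j B : measurable B -> measurable (F j @^-1` B).
Proof. by move=> mB; rewrite -[X in measurable X]setTI; exact: mF. Qed.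

Lemma measurable_chain k : measurable_fun setT (X k).
Proof.
elim: k => // k IH _ B mB; rewrite setTI.
rewrite -[X in measurable X]setIT -(labels_cover (gamma := gamma) k).
rewrite big_distrr/=.
apply: bigsetU_measurable => j _; rewrite preimage_step.
apply: measurableI; last exact: (measurable_label hgamma).
by rewrite -[X in measurable X]setTI; apply: IH => //; exact: mFpre.
Qed.

Let mXpre k B : measurable B -> measurable (X k @^-1` B).
Proof.
by move=> mB; rewrite -[X in measurable X]setTI; exact: measurable_chain.
Qed.

(** The induction on [k] splits on [gamma k]: given [gamma k = j], the event
    on [X k.+1] and [s] is one on [X k] and [j :: s].  In [step] only the last
    factor depends on [s'], so comparing [s' := s] with the empty word gives
    the product rule. *)
Lemma chain_cylinder_indep k s B : measurable B ->
  P (X k @^-1` B `&` cylinder gamma k s) =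
  (P (X k @^-1` B) * (J%:R^-1 ^+ size s)%:E)%E.
Proof.
elim: k s B => [|k IH] s B mB.
  by rewrite X0_indep// (prob_cylinder hgamma).
have step s' : P (X k.+1 @^-1` B `&` cylinder gamma k.+1 s') =
    (\sum_(j < J) P (X k @^-1` (F j @^-1` B)) * (J%:R^-1 ^+ (size s').+1)%:E)%E.
  rewrite (prob_split_label hgamma k); last first.
    by apply: measurableI; [exact: mXpre|exact: (measurable_cylinder hgamma)].
  apply: eq_bigr => j _; rewrite setIAC preimage_step -setIA.
  by rewrite (IH (j :: s'))//; exact: mFpre.
rewrite step -[X in P X]setIT -/(cylinder gamma k.+1 [::]) step /=.
rewrite -!ge0_sume_distrl; try by move=> j _; exact: measure_ge0.
by rewrite -muleA -EFinM expr1 exprS.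
Qed.

(** One step of the chain averages over the label.  On [gamma k = j] the
    integrand is a function of [X k], which is independent of that event. *)
Lemma ge0_integral_chainS (h : S -> R) k :
  measurable_fun setT h -> (forall x, 0 <= h x) ->
  (\int[P]_w (h (X k.+1 w))%:E =
   \int[P]_w (avg (fun j => h (F j (X k w))))%:E)%E.
Proof.
move=> mh h0.
have mhF j : measurable_fun setT (fun w => h (F j (X k w))).
  apply: (measurableT_comp mh); apply: (measurableT_comp (mF j)).
  exact: measurable_chain.
have Jge0 : 0 <= J%:R^-1 :> R by rewrite invr_ge0.
rewrite (ge0_integral_split_label hgamma k); last 2 first.
- by apply/measurable_EFinP/(measurableT_comp mh); exact: measurable_chain.
- by move=> w; rewrite lee_fin.
transitivity (\sum_(j < J) (NngNum Jge0)%:num%:E *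
    \int[P]_w (h (F j (X k w)))%:E)%E.
  apply: eq_bigr => j _; rewrite -(@integral_independent_event _ _ _ _ _
      (gamma k @^-1` [set j]))//.
  - by apply: eq_integral => w; rewrite inE /= XS => ->.
  - exact: (measurable_label hgamma).
  - move=> B mB; have := @chain_cylinder_indep k [:: j] (F j @^-1` (h @^-1` B)).
    rewrite /= setIT expr1; apply; apply: mFpre.
    by rewrite -[X in measurable X]setTI; exact: mh.
rewrite -ge0_sume_distrr; last first.
  by move=> j _; apply: integral_ge0 => w _; rewrite lee_fin.
rewrite -ge0_integral_sum//; last 2 first.
- by move=> j; exact/measurable_EFinP.
- by move=> j w _; rewrite lee_fin.
rewrite -ge0_integralZl//.
- by apply: eq_integral => w _; rewrite /avg EFinM sumEFin.
- by apply: emeasurable_sum => j; exact/measurable_EFinP.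
- by move=> w _; rewrite sume_ge0// => j _; rewrite lee_fin.
Qed.

End chain.

(** * Integrals of quadratic polynomials *)

Section integrable_EFin.
Context {dsp : measure_display} {T : measurableType dsp} {R : realType}.
Variable P : probability T R.

Lemma integrable_EFinD (f g : T -> R) :
  P.-integrable setT (EFin \o f) -> P.-integrable setT (EFin \o g) ->
  P.-integrable setT (EFin \o (fun w => f w + g w)).
Proof. by move=> fi gi; exact: (integrableD measurableT fi gi). Qed.

Lemma integrable_EFinZ (c : R) (f : T -> R) :
  P.-integrable setT (EFin \o f) ->
  P.-integrable setT (EFin \o (fun w => c * f w)).
Proof. by move=> fi; exact: (integrableZl measurableT c fi). Qed.

Lemma integrable_EFin_cst (c : R) : P.-integrable setT (EFin \o (fun=> c)).
Proof. exact: finite_measure_integrable_cst. Qed.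

End integrable_EFin.

Section quadratic_moments.
Context {dsp : measure_display} {T : measurableType dsp} {R : realType}.
Context {P : probability T R} {Y : T -> R}.
Hypothesis mY : measurable_fun setT Y.
Hypothesis Y0 : forall w, 0 <= Y w.
Hypothesis Y2 : (\int[P]_w (Y w ^+ 2)%:E < +oo)%E.

Let r : R := (\int[P]_w (Y w ^+ 2))%R.
Let m : R := (\int[P]_w (Y w))%R.

Lemma integral_sqr_EFin : (\int[P]_w (Y w ^+ 2)%:E = r%:E)%E.
Proof.
rewrite /r /Rintegral fineK// ge0_fin_numE//.
by apply: integral_ge0 => w _; rewrite lee_fin sqr_ge0.
Qed.

Let intY2 : P.-integrable setT (EFin \o (fun w => Y w ^+ 2)).
Proof.
apply/integrableP; split.
  by apply/measurable_EFinP; exact: measurable_funX.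
by under eq_integral do rewrite /= ger0_norm ?sqr_ge0//.
Qed.

Let intY : P.-integrable setT (EFin \o Y).
Proof.
apply: (@le_integrable _ _ _ _ _ _ _ (EFin \o (fun w => 1 + Y w ^+ 2))) => //.
- exact/measurable_EFinP.
(* [Y <= 1 + Y^2], so that a finite second moment suffices. *)
- move=> w _; rewrite /= lee_fin !ger0_norm ?addr_ge0 ?sqr_ge0//.
  by have := sqr_ge0 (Y w - 1); have := sqr_ge0 (Y w); nra.
- by apply: integrable_EFinD => //; exact: integrable_EFin_cst.
Qed.

Lemma integrable_quadratic a b c :
  P.-integrable setT (EFin \o (fun w => a * Y w ^+ 2 + b * Y w + c)).
Proof.
apply: integrable_EFinD; last exact: integrable_EFin_cst.
by apply: integrable_EFinD; exact: integrable_EFinZ.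
Qed.

Lemma Rintegral_quadratic a b c :
  (\int[P]_w (a * Y w ^+ 2 + b * Y w + c) = a * r + b * m + c)%R.
Proof.
rewrite RintegralD//; last 2 first.
- by apply: integrable_EFinD; exact: integrable_EFinZ.
- exact: integrable_EFin_cst.
rewrite RintegralD//; [|exact: integrable_EFinZ..].
by rewrite !RintegralZl// Rintegral_cst// [X in fine X]probability_setT mulr1.
Qed.

(** The variance of [Y] is nonnegative. *)
Lemma first_moment_le_sqrt : m <= Num.sqrt r.
Proof.
have m0 : 0 <= m by exact: Rintegral_ge0.
rewrite -(ger0_norm m0) -sqrtr_sqr ler_wsqrtr//.
have : (0 <= \int[P]_w (1 * Y w ^+ 2 + (- (2 * m)) * Y w + m ^+ 2))%R.
  apply: Rintegral_ge0 => w _.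
  by have := sqr_ge0 (Y w - m); nra.
by rewrite Rintegral_quadratic; nra.
Qed.

Lemma integral_le_quadratic (Z : T -> R) a b c :
  measurable_fun setT Z -> (forall w, 0 <= Z w) -> 0 <= b ->
  (forall w, Z w <= a * Y w ^+ 2 + b * Y w + c) ->
  (\int[P]_w (Z w)%:E <= (a * r + b * Num.sqrt r + c)%:E)%E.
Proof.
move=> mZ Z0 b0 ZY; apply: (@le_trans _ _ (a * r + b * m + c)%:E); last first.
  by rewrite lee_fin lerD2r lerD2l ler_wpM2l// first_moment_le_sqrt.
rewrite -Rintegral_quadratic /Rintegral fineK; last first.
  by apply: integrable_fin_num => //; exact: integrable_quadratic.
apply: ge0_le_integral => //.
- by move=> w _; rewrite lee_fin.
- exact/measurable_EFinP.
- exact: (measurable_int P (integrable_quadratic a b c)).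
- by move=> w _; rewrite lee_fin.
Qed.

Lemma integral_ge_quadratic (Z : T -> R) a b c :
  measurable_fun setT Z -> (forall w, 0 <= Z w) ->
  (\int[P]_w (Z w)%:E < +oo)%E -> b <= 0 ->
  (forall w, a * Y w ^+ 2 + b * Y w + c <= Z w) ->
  ((a * r + b * Num.sqrt r + c)%:E <= \int[P]_w (Z w)%:E)%E.
Proof.
move=> mZ Z0 Zfin b0 ZY; apply: (@le_trans _ _ (a * r + b * m + c)%:E).
  by rewrite lee_fin lerD2r lerD2l ler_wnM2l// first_moment_le_sqrt.
rewrite -Rintegral_quadratic /Rintegral fineK; last first.
  by apply: integrable_fin_num => //; exact: integrable_quadratic.
apply: le_integral => //.
- exact: integrable_quadratic.
- apply/integrableP; split; first exact/measurable_EFinP.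
  by under eq_integral do rewrite /= ger0_norm//.
- by move=> w _; rewrite lee_fin.
Qed.

End quadratic_moments.

(** * One step of stochastic gradient descent *)

Section one_step.
Context {R : realType} {d J : nat} {fs : 'I_J -> 'rV[R]_d -> R}
  {f : 'rV[R]_d -> R} {xopt : 'rV[R]_d} {lmax0 : R} {lmax : 'I_J -> R}
  {eta : R}.
Hypothesis J0 : (0 < J)%N.
Hypothesis dfs : forall j x, differentiable (fs j) x.
Hypothesis fE : f = fun x => avg (fun j => fs j x).
Hypothesis fmin : forall x, f xopt <= f x.
Hypothesis eta0 : 0 <= eta.
Hypothesis smooth : lambda_smooth f fs lmax0 lmax.

Let D0 := Num.sqrt (avg (fun j => enorm (gradient (fs j) xopt) ^+ 2)).
Let Lambda := Num.sqrt (avg (fun j => lmax j ^+ 2)).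

Let gradf x : gradient f x = J%:R^-1 *: \sum_j gradient (fs j) x.
Proof. by rewrite fE gradient_avg. Qed.

Lemma gradient_opt : gradient f xopt = 0.
Proof.
apply: gradient_at_min => // y; rewrite fE avg_funE.
by apply: differentiableZ; exact: differentiable_sum.
Qed.

(** Mean squared error after one step from the fixed point [x], over a
    uniform label. *)
Definition step_error x :=
  avg (fun j => enorm (x - eta *: gradient (fs j) x - xopt) ^+ 2).

Let step_errorE x : step_error x =
  enorm (x - xopt) ^+ 2
  - 2 * eta * dotv (gradient f x - gradient f xopt) (x - xopt)
  + eta ^+ 2 * avg (fun j => enorm (gradient (fs j) x) ^+ 2).
Proof.
rewrite gradient_opt subr0 gradf -avg_sqr_step//.
by congr avg; apply/funext => j; rewrite addrAC.
Qed.

Lemma gradient_inner_bound x :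
  `|dotv (gradient f x - gradient f xopt) (x - xopt)| <=
  lmax0 * enorm (x - xopt) ^+ 2.
Proof.
case: smooth => _ _ Lf _; rewrite expr2 mulrA.
by apply: le_trans (cauchy_schwarz _ _) _; rewrite ler_wpM2r ?enorm_ge0.
Qed.

Lemma step_error_ge x :
  (1 - 2 * eta * lmax0) * enorm (x - xopt) ^+ 2
  + (- (2 * eta ^+ 2 * Lambda * D0)) * enorm (x - xopt)
  + eta ^+ 2 * D0 ^+ 2 <= step_error x.
Proof.
case: (smooth) => _ _ _ Lfs; rewrite step_errorE.
have h1 := ler_wpM2l eta0 (le_trans (ler_norm _) (gradient_inner_bound x)).
have h2 := ler_wpM2l (sqr_ge0 eta) (second_moment_ge (enorm_ge0 (x - xopt))
  (fun j => Lfs j x xopt)).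
rewrite -/D0 -/Lambda in h2; lra.
Qed.

(** The lower bound on the inner product is a parameter: strong convexity
    provides [mu = lmin], while smoothness alone provides [mu = - lmax0], which
    is enough for finiteness of the mean squared errors. *)
Lemma step_error_le mu x :
  mu * enorm (x - xopt) ^+ 2 <=
    dotv (gradient f x - gradient f xopt) (x - xopt) ->
  step_error x <=
  (1 - 2 * eta * mu + eta ^+ 2 * Lambda ^+ 2) * enorm (x - xopt) ^+ 2
  + 2 * eta ^+ 2 * Lambda * D0 * enorm (x - xopt) + eta ^+ 2 * D0 ^+ 2.
Proof.
move=> mux; case: (smooth) => _ _ _ Lfs; rewrite step_errorE.
have h1 := ler_wpM2l eta0 mux.
have h2 := ler_wpM2l (sqr_ge0 eta) (second_moment_le (enorm_ge0 (x - xopt))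
  (fun j => Lfs j x xopt)).
rewrite -/D0 -/Lambda in h2; lra.
Qed.

(** Relative to [step_error_le] this adds [eta^2 (lmax0^2 - lmin^2) |e|^2],
    which is nonnegative since [lmin <= lmax0] unless [e = 0]. *)
Lemma step_error_le_strongly_convex lmin x : strongly_convex f lmin ->
  step_error x <=
  (1 - 2 * eta * lmin + eta ^+ 2 * (lmax0 ^+ 2 + Lambda ^+ 2 - lmin ^+ 2))
    * enorm (x - xopt) ^+ 2
  + 2 * eta ^+ 2 * Lambda * D0 * enorm (x - xopt) + eta ^+ 2 * D0 ^+ 2.
Proof.
move=> [lmin0 sc]; apply: le_trans (step_error_le (sc x xopt)) _.
rewrite !lerD2r; set t := enorm _ ^+ 2.
have t0 : 0 <= t by exact: sqr_ge0.
have lt : lmin * t <= lmax0 * t :=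
  le_trans (sc x xopt) (le_trans (ler_norm _) (gradient_inner_bound x)).
have : lmin ^+ 2 * t <= lmax0 ^+ 2 * t.
  move: t0; rewrite le_eqVlt => /predU1P[<-|t0]; first by rewrite !mulr0.
  move: lt; rewrite ler_pM2r// => ll.
  apply: ler_wpM2r; first exact: ltW.
  by rewrite ler_sqr// nnegrE ?(le_trans _ ll) ?ltW.
by move=> /(ler_wpM2l (sqr_ge0 eta)); lra.
Qed.

End one_step.

(** * The mean squared error recursion *)

Theorem theorem3p1 (R : realType) (d J : nat) (hd : (0 < d)%N) (hJ : (0 < J)%N)
    (fs : 'I_J -> 'rV[R]_d -> R)
    (hfs : forall j x, differentiable (fs j) x)
    (f : 'rV[R]_d -> R) (hf : f = fun x => avg (fun j => fs j x))
    (xopt : 'rV[R]_d) (hopt : forall x, f xopt <= f x)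
    (lmax0 : R) (lmax : 'I_J -> R) (D0 Lambda : R)
    (hD0 : D0 = Num.sqrt (avg (fun j => enorm (gradient (fs j) xopt) ^+ 2)))
    (hLambda : Lambda = Num.sqrt (avg (fun j => lmax j ^+ 2)))
    (eta : R) (heta : 0 < eta < lmax0^-1)
    (dsp : measure_display) (T : measurableType dsp) (P : probability T R)
    (gamma : nat -> T -> 'I_J) (hgamma : iid_uniform P gamma)
    (theta : nat -> T -> 'rV[R]_d)
    (htheta0 : random_element (@borel_rV R d) (theta 0%N))
    (hindep : independent2 P (sigma_gen (@borel_rV R d) (theta 0%N))
                             (sigma_gen_seq gamma))
    (hmse0 : (mse P (theta 0%N) xopt < +oo)%E)
    (htheta : forall k w, theta k.+1 w =
       theta k w - eta *: gradient (fs (gamma k w)) (theta k w))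
    (Rk : nat -> \bar R) (hRk : forall k, Rk k = mse P (theta k) xopt)
    (hsmooth : lambda_smooth f fs lmax0 lmax) :
  (forall k : nat,
     (Rk k.+1 - Rk k >=
        (- (2 * eta * lmax0))%:E * Rk k
        - (2 * eta ^+ 2 * Lambda * D0)%:E * sqrte (Rk k)
        + (eta ^+ 2 * D0 ^+ 2)%:E)%E) /\
  (forall lmin : R, strongly_convex f lmin ->
   forall k : nat,
     (Rk k.+1 - Rk k <=
        (- (2 * eta * lmin)
         + eta ^+ 2 * (lmax0 ^+ 2 + Lambda ^+ 2 - lmin ^+ 2))%:E * Rk k
        + (2 * eta ^+ 2 * Lambda * D0)%:E * sqrte (Rk k)
        + (eta ^+ 2 * D0 ^+ 2)%:E)%E).
Proof.
have [eta0 _] := andP heta.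
(* The iterates form a chain driven by the labels, with transitions [F j]. *)
pose F j (x : borelType R d) : borelType R d := x - eta *: gradient (fs j) x.
have cF j : continuous (F j : 'rV[R]_d -> 'rV[R]_d).
  case: hsmooth => _ _ _ Lfs; apply: continuous_gradient_step.
  exact: (lipschitz_enorm_continuous (Lfs j)).
have mF j : measurable_fun setT (F j) := continuous_measurable_borel (cF j).
have mT0 : measurable_fun setT (theta 0%N : T -> borelType R d).
  by move=> _ B mB; apply: htheta0; exists B.
have T0i B s : measurable (B : set (borelType R d)) ->
    P (theta 0%N @^-1` B `&` cylinder gamma 0 s) =
    (P (theta 0%N @^-1` B) * P (cylinder gamma 0 s))%E.
  move=> mB; apply: hindep; last exact: cylinder_sigma_gen_seq.
  by exists B => //; rewrite setTI.
have mTk k : measurable_fun setT (theta k : T -> borelType R d).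
  exact: (measurable_chain hgamma mF mT0 htheta).
pose Y k w := enorm (theta k w - xopt).
pose h (x : borelType R d) := enorm (x - xopt).
have mh : measurable_fun setT h.
  apply: continuous_measurable_real => x.
  apply: (@continuous_comp _ _ _ (fun x : 'rV[R]_d => x - xopt) (@enorm R d));
    last exact: enorm_continuous.
  apply: (@continuousB _ _ _ id (fun=> xopt)); last exact: cst_continuous.
  by move=> ?.
have mY k : measurable_fun setT (Y k) by exact: (measurableT_comp mh (mTk k)).
have Y0 k w : 0 <= Y k w by exact: enorm_ge0.
have RkE k : Rk k = (\int[P]_w (Y k w ^+ 2)%:E)%E by rewrite hRk /mse unlock.
pose Z k w := @step_error R d J fs xopt eta (theta k w).
have mZ k : measurable_fun setT (Z k).
  apply: measurable_funM => //; apply: measurable_sum => j.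
  apply: measurable_funX; apply: (measurableT_comp mh).
  by apply: (measurableT_comp (mF j)).
have Z0 k w : 0 <= Z k w by apply: avg_ge0 => j; exact: sqr_ge0.
have RkS k : Rk k.+1 = (\int[P]_w (Z k w)%:E)%E.
  rewrite RkE (ge0_integral_chainS hJ hgamma mF mT0 T0i htheta
    (h := fun x => h x ^+ 2))//.
  - exact: measurable_funX.
  - by move=> x; exact: sqr_ge0.
have D0_ge0 : 0 <= D0 by rewrite hD0 sqrtr_ge0.
have L_ge0 : 0 <= Lambda by rewrite hLambda sqrtr_ge0.
have b_ge0 : 0 <= 2 * eta ^+ 2 * Lambda * D0.
  do 3![apply: mulr_ge0 => //]; exact: sqr_ge0.
(* With [mu = - lmax0], which smoothness provides, the quadratic upper bound
   propagates finiteness of the second moment from [k] to [k.+1]. *)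
have Rfin k : (Rk k < +oo)%E.
  elim: k => [|n IH]; first by rewrite hRk.
  rewrite RkS; rewrite RkE in IH.
  apply: (le_lt_trans (integral_le_quadratic (mY n) (Y0 n) IH (mZ n) (Z0 n)
    b_ge0 _)).
    move=> w; rewrite hLambda hD0.
    apply: (step_error_le hJ hfs hf hopt (ltW eta0) hsmooth (mu := - lmax0)).
    have := gradient_inner_bound (xopt := xopt) hsmooth (theta n w).
    by rewrite ler_norml -mulNr => /andP[].
  exact: ltry.
pose r k : R := (\int[P]_w (Y k w ^+ 2))%R.
have Rkr k : Rk k = (r k)%:E.
  by rewrite RkE integral_sqr_EFin// -RkE.
have Y2fin k : (\int[P]_w (Y k w ^+ 2)%:E < +oo)%E by rewrite -RkE.
split=> [k|lmin sc k]; rewrite !Rkr /= -!EFinM -?EFinN -!EFinD lee_fin.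
- have : (((1 - 2 * eta * lmax0) * r k
      + (- (2 * eta ^+ 2 * Lambda * D0)) * Num.sqrt (r k)
      + eta ^+ 2 * D0 ^+ 2)%:E <= (r k.+1)%:E)%E.
    rewrite -Rkr RkS; apply: integral_ge_quadratic => //.
    + by rewrite -RkS.
    + by rewrite oppr_le0.
    + move=> w; rewrite hLambda hD0.
      exact: (step_error_ge hJ hfs hf hopt (ltW eta0) hsmooth).
  by rewrite lee_fin; lra.
- have : ((r k.+1)%:E <= ((1 - 2 * eta * lmin
        + eta ^+ 2 * (lmax0 ^+ 2 + Lambda ^+ 2 - lmin ^+ 2)) * r k
      + 2 * eta ^+ 2 * Lambda * D0 * Num.sqrt (r k) + eta ^+ 2 * D0 ^+ 2)%:E)%E.
    rewrite -Rkr RkS; apply: integral_le_quadratic => //.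
    move=> w; rewrite hLambda hD0.
    exact: (step_error_le_strongly_convex hJ hfs hf hopt (ltW eta0) hsmooth).
  by rewrite lee_fin; lra.
Qed.
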